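(* Let $G$ be a group with identity $e$, let $R$ be a $G$-graded commutative ring with nonzero unity, let $M$ be a $G$-graded unitary $R$-module, and let $\phi: GS(M)\rightarrow GS(M)\cup\{\emptyset\}$ be a function with $\phi(L)\subseteq L$ for all $L\in GS(M)$. Let $g\in G$ and let $K$ be a $g$-$\phi$-prime $R$-submodule of $M$ which is not $g$-prime. If $\phi(K)\subseteq(K:_{R_e}M)^2K_g$, then $\phi(K)=(K:_{R_e}M)^iK_g$ for all integers $i\geq1$.
   Context: $G$ is a group with identity $e$. $R=\bigoplus_{h\in G}R_h$ is a $G$-graded commutative ring with nonzero unity $1$ ($R_h$ additive subgroups, $R_hR_k\subseteq R_{hk}$), and $M=\bigoplus_{h\in G}M_h$ is a $G$-graded unitary $R$-module ($M_h$ additive subgroups, $R_hM_k\subseteq M_{hk}$). An $R$-submodule $K$ of $M$ is graded if $K=\bigoplus_{h\in G}(K\cap M_h)$; write $K_h=K\cap M_h$. $GS(M)$ is the set of all graded $R$-submodules of $M$. Notation: $(K:_RM)=\{r\in R: rM\subseteq K\}$ and $(K:_{R_e}M)=\{r\in R_e: rM\subseteq K\}$, an ideal of the ring $R_e$; $(K:_{R_e}M)^i$ is its $i$-th power as an ideal of $R_e$, and $(K:_{R_e}M)^iK_g$ denotes the additive subgroup ($R_e$-submodule of $M_g$) generated by the products $st$ with $s\in(K:_{R_e}M)^i$, $t\in K_g$. $K-\phi(K)$ denotes set difference. Let $g\in G$ and let $K$ be a graded $R$-submodule of $M$ with $K_g\neq M_g$. - $K$ is a $g$-$\phi$-prime $R$-submodule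 of $M$ if whenever $r\in R_e$ and $m\in M_g$ satisfy $rm\in K-\phi(K)$, then $m\in K$ or $r\in(K:_RM)$. - $K$ is a $g$-prime $R$-submodule of $M$ if whenever $r\in R_e$ and $m\in M_g$ satisfy $rm\in K$, then $m\in K$ or $r\in(K:_RM)$. *)

(* Defs.v *)
From HB Require Import structures.
From mathcomp Require Import all_boot all_algebra finmap.
From mathcomp Require Import boolp classical_sets functions cardinality fsbigop.

Set Implicit Arguments.
Unset Strict Implicit.
Unset Printing Implicit Defensive.

Import GRing.Theory.

Local Open Scope classical_set_scope.
Local Open Scope ring_scope.

(* A is the internal direct sum of the family of additive subgroups V_. *)
Record internal_direct_sum (G : choiceType) (V : zmodType)
    (A : set V) (V_ : G -> set V) : Prop := {
  ids_zmod : forall h, zmod_closed [in V_ h];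
  ids_sub : forall h, V_ h `<=` A;
  ids_decomp : forall x, A x ->
    exists! c : G -> V,
      [/\ forall h, V_ h (c h),
          finite_set [set h | c h != 0] &
          x = \sum_(h \in [set: G]) c h] }.

Record graded_ring (G : groupType) (R : comNzRingType)
    (R_ : G -> set R) : Prop := {
  gr_ring_sum : internal_direct_sum [set: R] R_;
  gr_ring_mul : forall (h k : G) (r s : R),
    R_ h r -> R_ k s -> R_ (h * k)%g (r * s) }.

Record graded_module (G : groupType) (R : comNzRingType) (M : lmodType R)
    (R_ : G -> set R) (M_ : G -> set M) : Prop := {
  gr_mod_sum : internal_direct_sum [set: M] M_;
  gr_mod_scale : forall (h k : G) (r : R) (m : M),
    R_ h r -> M_ k m -> M_ (h * k)%g (r *: m) }.

Definition graded_submodule (G : groupType) (R : comNzRingType)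
    (M : lmodType R) (M_ : G -> set M) (K : set M) : Prop :=
  submod_closed [in K] /\ internal_direct_sum K (fun h => K `&` M_ h).

Record GS (G : groupType) (R : comNzRingType) (M : lmodType R)
    (M_ : G -> set M) : Type := {
  GS_set :> set M;
  GS_prop : graded_submodule M_ GS_set }.

(* The codomain of phi, i.e. GS(M) together with the empty set. *)
Record GS0 (G : groupType) (R : comNzRingType) (M : lmodType R)
    (M_ : G -> set M) : Type := {
  GS0_set :> set M;
  GS0_prop : graded_submodule M_ GS0_set \/ GS0_set = set0 }.

(* (K :_R M) *)
Definition colon (R : comNzRingType) (M : lmodType R) (K : set M) : set R :=
  [set r | forall m : M, K (r *: m)].

(* (K :_{R_e} M) *)
Definition colon_e (G : groupType) (R : comNzRingType) (M : lmodType R)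
    (R_ : G -> set R) (K : set M) : set R :=
  R_ 1%g `&` colon K.

(* The additive subgroup generated by the products s *: t; taking M := R^o
   gives the product of ideals. *)
Definition prod_span (R : comNzRingType) (M : lmodType R)
    (S : set R) (T : set M) : set M :=
  smallest (fun A : set M => zmod_closed [in A])
    [set s *: t | s in S & t in T].

(* The n-th power of I as an ideal of the subring S (S itself if n = 0). *)
Definition ideal_exp (R : comNzRingType) (S I : set R) (n : nat) : set R :=
  iter n (fun J : set R => @prod_span R R^o I J) S.

Definition g_phi_prime (G : groupType) (R : comNzRingType) (M : lmodType R)
    (R_ : G -> set R) (M_ : G -> set M) (phi : GS M_ -> GS0 M_)
    (g : G) (K : GS M_) : Prop :=
  K `&` M_ g <> M_ g /\
  forall (r : R) (m : M), R_ 1%g r -> M_ g m ->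
    (K `\` phi K) (r *: m) -> (K : set M) m \/ colon K r.

Definition g_prime (G : groupType) (R : comNzRingType) (M : lmodType R)
    (R_ : G -> set R) (M_ : G -> set M) (g : G) (K : GS M_) : Prop :=
  K `&` M_ g <> M_ g /\
  forall (r : R) (m : M), R_ 1%g r -> M_ g m ->
    (K : set M) (r *: m) -> (K : set M) m \/ colon K r.

(* Main.v *)
Require Import Defs.
From mathcomp Require Import all_boot all_algebra.
From mathcomp Require Import boolp classical_sets.

(** Write I for [(K :_{R_e} M)] and P_i for I^i K_g. Since K is g-phi-prime
    but not g-prime, some r in R_e and m in M_g violate primeness: [r *: m]
    lies in K, while neither m lies in K nor r in [(K :_R M)]. For every such
    pair [r *: m] must lie in phi(K), and the violation survives when m is
    moved by an element k of K_g or r by an element a of I. So phi(K), which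
    is therefore non-empty and hence a submodule, contains r m, r (m + k),
    (r + a) m and (r + a) (m + k), and with them the alternating sum a k
    (lemma [colon_e_scale_phi]). This gives P_1 `<=` phi(K); together with
    phi(K) `<=` P_2 `<=` P_1 it yields phi(K) = P_1 = P_2. Associativity of
    the product of additive spans (lemma [prod_spanA]) gives
    P_(i+1) = I P_i, so the equality P_1 = P_2 propagates to all larger
    exponents. *)

Import GRing.Theory.

Local Open Scope classical_set_scope.
Local Open Scope ring_scope.

Lemma zmod_closed_setP {V : zmodType} {A : set V} :
  zmod_closed [in A] <-> A 0 /\ forall x y, A x -> A y -> A (x - y).
Proof.
split=> [[A0 AB]|[A0 AB]]; split.
- by move: A0; rewrite inE.
- by move=> x y Ax Ay; have := AB x y; rewrite !inE; exact.
- by rewrite inE.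
- by move=> x y; rewrite !inE; exact: AB.
Qed.

Lemma zmod_closed_setB {V : zmodType} {A : set V} {x y : V} :
  zmod_closed [in A] -> A x -> A y -> A (x - y).
Proof. by move=> /zmod_closed_setP[_]; exact. Qed.

Lemma zmod_closed_setD {V : zmodType} {A : set V} {x y : V} :
  zmod_closed [in A] -> A x -> A y -> A (x + y).
Proof.
move=> Azmod Ax Ay; have [A0 _] := zmod_closed_setP.1 Azmod.
rewrite -[y]opprK; apply: (zmod_closed_setB Azmod Ax).
by rewrite -[- y]sub0r; exact: (zmod_closed_setB Azmod A0 Ay).
Qed.

Lemma zmod_closed_preimage {V W : zmodType} {f : V -> W} {A : set W} :
  {morph f : x y / x - y} -> zmod_closed [in A] -> zmod_closed [in f @^-1` A].
Proof.
move=> fB Azmod; have [A0 _] := zmod_closed_setP.1 Azmod.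
apply/zmod_closed_setP; split=> [|x y Ax Ay] /=.
  by rewrite -(subrr 0) fB subrr.
by rewrite fB; exact: zmod_closed_setB.
Qed.

Lemma zmod_closed_setI {V : zmodType} {A B : set V} :
  zmod_closed [in A] -> zmod_closed [in B] -> zmod_closed [in A `&` B].
Proof.
move=> Azmod Bzmod; have [[A0 AB] [B0 BB]] :=
  (zmod_closed_setP.1 Azmod, zmod_closed_setP.1 Bzmod).
apply/zmod_closed_setP; split=> [|x y [Ax Bx] [Ay By]]; split=> //.
  exact: AB.
exact: BB.
Qed.

Lemma prod_span_zmod_closed {R : comNzRingType} {M : lmodType R}
  {S : set R} {U : set M} : zmod_closed [in prod_span S U].
Proof.
apply/zmod_closed_setP; split=> [A [/zmod_closed_setP[]] //|x y Px Py A AP].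
by apply: (zmod_closed_setB AP.1); [exact: Px | exact: Py].
Qed.

Lemma prod_span_scale {R : comNzRingType} {M : lmodType R}
    {S : set R} {U : set M} {s : R} {u : M} :
  S s -> U u -> prod_span S U (s *: u).
Proof. by move=> Ss Uu A [_]; apply; exists s => //; exists u. Qed.

Lemma prod_span_sub {R : comNzRingType} {M : lmodType R}
    {S : set R} {U A : set M} : zmod_closed [in A] ->
  (forall s u, S s -> U u -> A (s *: u)) -> prod_span S U `<=` A.
Proof.
by move=> Azmod SUA x; apply; split=> // _ [s Ss [u Uu <-]]; exact: SUA.
Qed.

Lemma prod_span_mono {R : comNzRingType} {M : lmodType R}
    {S T : set R} {U A : set M} :
  S `<=` T -> U `<=` A -> prod_span S U `<=` prod_span T A.
Proof.
move=> ST UA; apply: (prod_span_sub prod_span_zmod_closed) => s u Ss Uu.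
by apply: prod_span_scale; [exact: ST | exact: UA].
Qed.

(** Each inclusion is reduced to generators twice: the elements that scaling
    carries into a given additive subgroup again form an additive subgroup,
    so it suffices to look at generators of the inner span. *)
Lemma prod_spanA {R : comNzRingType} {M : lmodType R}
    (S T : set R) (U : set M) :
  prod_span (@prod_span R R^o S T) U = prod_span S (prod_span T U).
Proof.
rewrite eqEsubset; split; apply: (prod_span_sub prod_span_zmod_closed).
- move=> x u + Uu; pose f (y : R^o) : M := (y : R) *: u.
  have fB : {morph f : y z / y - z} by move=> y z; exact: scalerBl.
  apply: (prod_span_sub (zmod_closed_preimage fB prod_span_zmod_closed)).
  move=> s t Ss Tt; rewrite /preimage /= /f -scalerA.
  by apply: prod_span_scale Ss _; exact: prod_span_scale.
- move=> s v Ss; have fB : {morph *:%R s : y z / y - z :> M}.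
    by move=> y z; exact: scalerBr.
  apply: (prod_span_sub (zmod_closed_preimage fB prod_span_zmod_closed)).
  move=> t u Tt Uu; rewrite /preimage /= scalerA.
  by apply: prod_span_scale Uu; exact: (@prod_span_scale R R^o).
Qed.

Lemma submod_closed_colon_zmod_closed {R : comNzRingType} {M : lmodType R}
  {K : set M} : submod_closed [in K] -> zmod_closed [in colon K].
Proof.
move=> /GRing.submod_closedB Kzmod.
have [K0 _] := zmod_closed_setP.1 Kzmod.
apply/zmod_closed_setP; split=> [m|r s Kr Ks m]; first by rewrite scale0r.
by rewrite scalerBl; exact: zmod_closed_setB.
Qed.

Lemma ideal_exp1_sub {G : groupType} {R : comNzRingType} {M : lmodType R}
    {R_ : G -> set R} {K : set M} :
  graded_ring R_ -> submod_closed [in K] ->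
  ideal_exp (R_ 1%g) (colon_e R_ K) 1 `<=` colon_e R_ K.
Proof.
move=> [[R_zmod _ _] R_mul] Ksub.
apply: (@prod_span_sub R R^o).
  exact: zmod_closed_setI (R_zmod _) (submod_closed_colon_zmod_closed Ksub).
move=> s t [Rs Ks] Rt; split; first by rewrite -[1%g]mulg1; exact: R_mul.
by move=> m; have := Ks (t *: m); rewrite scalerA.
Qed.

(** The core of the argument. A pair (r, m) violating primeness remains a
    violation when r is replaced by r + a or m by m + k, because a lies in the
    colon and k in K; phi-primeness puts the product of each violating pair in
    phi(K). One such product already excludes phi(K) being empty, so phi(K) is
    an additive subgroup. *)
Lemma colon_e_scale_phi {G : groupType} {R : comNzRingType} {M : lmodType R}
    {R_ : G -> set R} {M_ : G -> set M} {phi : GS M_ -> GS0 M_}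
    {g : G} {K : GS M_} :
  graded_ring R_ -> graded_module R_ M_ ->
  g_phi_prime R_ phi g K -> ~ g_prime R_ g K ->
  zmod_closed [in (phi K : set M)] /\
  forall a k, colon_e R_ K a -> (K `&` M_ g) k -> (phi K : set M) (a *: k).
Proof.
move=> [[R_zmod _ _] _] [[M_zmod _ _] _] [Kg Kphi] nprime.
have [Ksub _] := GS_prop K; have Kzmod := GRing.submod_closedB Ksub.
have Czmod := submod_closed_colon_zmod_closed Ksub.
have Re := R_zmod 1%g; have Mg := M_zmod g.
have phiP r m : R_ 1%g r -> M_ g m -> (K : set M) (r *: m) ->
    ~ (K : set M) m -> ~ colon K r -> (phi K : set M) (r *: m).
  move=> Rr Mm Krm nKm nCr; apply: contrapT => nphi.
  by case: (Kphi r m Rr Mm).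
have [r [m [Rr Mm Krm nKm nCr]]] : exists r m, [/\ R_ 1%g r, M_ g m,
    (K : set M) (r *: m), ~ (K : set M) m & ~ colon K r].
  apply: contrapT => none; apply: nprime; split=> // r m Rr Mm Krm.
  apply: contrapT => /not_orP[nKm nCr].
  by apply: none; exists r, m.
have phirm := phiP r m Rr Mm Krm nKm nCr.
have phizmod : zmod_closed [in (phi K : set M)].
  case: (GS0_prop (phi K)) => [[/GRing.submod_closedB] //|phi0].
  by move: phirm; rewrite phi0.
split=> // a k [Ra Ca] [Kk Mk].
have Kscale s : (K : set M) (s *: k).
  by case: Ksub => K0 /(_ s k 0); rewrite !inE addr0 in K0 *; apply.
have nKmk : ~ (K : set M) (m + k).
  by move=> /(zmod_closed_setB Kzmod)/(_ Kk); rewrite addrK.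
have nCra : ~ colon K (r + a).
  by move=> /(zmod_closed_setB Czmod)/(_ Ca); rewrite addrK.
have Mmk := zmod_closed_setD Mg Mm Mk.
have Rra := zmod_closed_setD Re Rr Ra.
have Krmk : (K : set M) (r *: (m + k)).
  by rewrite scalerDr; exact: (zmod_closed_setD Kzmod).
have Kra n : (K : set M) (r *: n) -> (K : set M) ((r + a) *: n).
  by move=> Krn; rewrite scalerDl; exact: (zmod_closed_setD Kzmod).
(* All four products below come from violating pairs; only a k survives in
   their alternating sum. *)
have -> : a *: k =
    ((r + a) *: (m + k) - (r + a) *: m) - (r *: (m + k) - r *: m).
  by rewrite -!scalerBr [m + k]addrC addrK -scalerBl [r + a]addrC addrK.
apply: (zmod_closed_setB phizmod); apply: (zmod_closed_setB phizmod) => //.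
- exact: phiP (Kra _ Krmk) nKmk nCra.
- exact: phiP (Kra _ Krm) nKm nCra.
- exact: phiP Krmk nKmk nCr.
Qed.

Theorem corollary2p5 (G : groupType) (R : comNzRingType) (M : lmodType R)
    (R_ : G -> set R) (M_ : G -> set M)
    (hR : graded_ring R_) (hM : graded_module R_ M_)
    (phi : GS M_ -> GS0 M_) (hphi : forall L : GS M_, phi L `<=` L)
    (g : G) (K : GS M_)
    (hK : g_phi_prime R_ phi g K) (hnK : ~ g_prime R_ g K)
    (hsub : phi K `<=`
      prod_span (ideal_exp (R_ 1%g) (colon_e R_ K) 2) (K `&` M_ g)) :
  forall i : nat, (1 <= i)%N ->
    (phi K : set M) =
      prod_span (ideal_exp (R_ 1%g) (colon_e R_ K) i) (K `&` M_ g).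
Proof.
have [phizmod phiIK] := colon_e_scale_phi hR hM hK hnK.
have [Ksub _] := GS_prop K.
have I1I := ideal_exp1_sub hR Ksub.
set I := colon_e R_ K in I1I phiIK hsub *.
pose P i := prod_span (ideal_exp (R_ 1%g) I i) (K `&` M_ g).
have PS i : P i.+1 = prod_span I (P i) by exact: prod_spanA.
have P1phi : P 1%N `<=` phi K.
  by apply: (prod_span_sub phizmod) => s k /I1I; exact: phiIK.
(* I^2 = I I^1 lies in I R_e = I^1, since I^1 lies in R_e. *)
have P21 : P 2%N `<=` P 1%N.
  apply: prod_span_mono => //; apply: (@prod_span_mono R R^o) => // s.
  by move=> /I1I[].
have P12 : P 1%N = P 2%N by rewrite eqEsubset; split=> // x /P1phi/hsub.
have phi1 : (phi K : set M) = P 1%N.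
  by rewrite eqEsubset; split=> // x /hsub/P21.
suff PE i : P i.+1 = P 1%N by case=> // i _; rewrite phi1 -(PE i).
by elim: i => // i IHi; rewrite PS IHi -PS.
Qed.
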